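(* Let $n,k$ be integers with $2\le k\le n-2$. In the following cases every self-Bäcklund $(n,k)$-gon is trivial: (1) $n$ is arbitrary, $k=2$; (2) $n$ is odd, $k=3$; (3) $k$ is arbitrary, $n=2k+1$; (4) $n=3k$. On the other hand, there exist non-trivial self-Bäcklund $(n,k)$-gons in the following cases: (1) $n$ is even and $k$ is odd; (2) $n=2k$, with $k>2$.
   Context: For $u,v\in\mathbb{R}^2$, $[u,v]$ denotes the determinant of the matrix with columns $u,v$. For $2\le k\le n-2$, a self-Bäcklund $(n,k)$-gon is an origin-symmetric $2n$-gon in $\mathbb{R}^2$ with vertices $P_1,\dots,P_{2n}$ (indices understood cyclically modulo $2n$), $P_{i+n}=-P_i$ for all $i$, such that $[P_i,P_{i+1}]=1$ for all $i$ and there is a constant $c$ with $[P_i,P_{i+k}]=c$ for all $i$. (Since $P_{i+n}=-P_i$, one can assume without loss of generality that $k\le n/2$.) A self-Bäcklund $(n,k)$-gon is called trivial if it is a regular $2n$-gon centered at the origin (scaled so that $[P_i,P_{i+1}]=1$) or the image of such a polygon under an element of $\mathrm{SL}_2(\mathbb{R})$. *)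

(* Defs.v *)
From HB Require Import structures.
From mathcomp Require Import all_boot all_order all_algebra.
From mathcomp Require Import all_classical all_reals all_analysis.

Set Implicit Arguments.
Unset Strict Implicit.
Unset Printing Implicit Defensive.

Import Order.TTheory GRing.Theory Num.Theory.

Local Open Scope ring_scope.

Definition bracket (R : realType) (u v : 'cV[R]_2) : R :=
  \det (row_mx u v : 'M[R]_(2, 1 + 1)).

(** A 2n-gon is given by its vertices, indexed cyclically by Z/2n.  The type
    ['Z_(2 * n)] is Z/2n only when [2 * n > 1]; it is used below with [n >= 4].

    The vertices of a 2n-gon are pairwise distinct, but sides may cross: no
    convexity is assumed.  Distinctness excludes degenerate closed sequences
    such as a 2k-gon traversed three times, which would satisfy the other
    conditions with n = 3k and c = 0. *)
Record self_backlund (R : realType) (n k : nat) (P : 'Z_(2 * n) -> 'cV[R]_2)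
    : Prop := SelfBacklund {
  sb_distinct : injective P;
  sb_symmetric : forall i, P (i + n%:R) = - P i;
  sb_side : forall i, bracket (P i) (P (i + 1)) = 1;
  sb_diagonal : exists c : R, forall i, bracket (P i) (P (i + k%:R)) = c
}.

(** Regular 2n-gons {2n/m} centred at the origin, with m coprime to 2n.  The
    convex one is m = 1 (or 2n - 1, with the reverse orientation); the star
    ones have to be included because the polygons above need not be convex. *)
Definition regular_polygon (R : realType) (n : nat)
    (Q : 'Z_(2 * n) -> 'cV[R]_2) : Prop :=
  exists (r phi : R) (m : nat), [/\ 0 < r, coprime m (2 * n) &
    forall i : 'Z_(2 * n),
      let t := phi + (m * i)%N%:R * (2 * pi / (2 * n)%N%:R) in
      Q i = \col_(j < 2) (r * (if j == 0 then cos t else sin t))].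

Definition trivial_polygon (R : realType) (n : nat)
    (P : 'Z_(2 * n) -> 'cV[R]_2) : Prop :=
  exists (A : 'M[R]_2) (Q : 'Z_(2 * n) -> 'cV[R]_2),
    [/\ \det A = 1, regular_polygon Q,
        forall i, bracket (Q i) (Q (i + 1)) = 1
      & forall i, P i = A *m Q i].

(* Main.v *)
Require Import Defs.
From HB Require Import structures.
From mathcomp Require Import all_boot all_order all_algebra.
From mathcomp Require Import all_classical all_reals all_analysis.
From mathcomp Require Import ring lra zify.

Set Implicit Arguments.
Unset Strict Implicit.
Unset Printing Implicit Defensive.

Import Order.TTheory GRing.Theory Num.Theory.

Local Open Scope ring_scope.

(** Write f_j for the vertices as a sequence indexed by natural numbers, so that
    f_(j+n) = -f_j and [f_j, f_(j+1)] = 1.  Cramer's rule in the plane gives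
    the discrete Hill equation f_(j+2) = a_j f_(j+1) - f_j with coefficient
    a_j = [f_j, f_(j+2)], and the polygon is trivial exactly when a_j does not
    depend on j.

    If a_j = a, the numbers |[f_0, f_j]| would strictly increase when |a| >= 2,
    against [f_0, f_n] = 0 ([hill_coefficient_lt2]).  So a = 2 cos t with
    0 < t < pi, and the solution is a linear image of j |-> (cos jt, sin jt)
    ([constant_hill_rotation]).  The relation f_n = -f_0 makes t a multiple
    m pi / n, and distinctness of the vertices makes m coprime to 2n
    ([trivial_of_constant_hill]).

    Rigidity thus asks for a constant a_j.
    - For k = 2, a_j is the given constant.
    - For k = 3, [f_j, f_(j+3)] = a_j a_(j+1) - 1, a constant; no a_j
      vanishes, so a is 2-periodic, and it is also n-periodic, with n odd ([rigid_odd3]).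
    - For n = 2k+1, the brackets with f_(j+k+1) give
      f_(j+k+1) = c (f_(j+1) - f_j); two applications of this relation
      express -f_(j+1) by f_j, f_(j+1), f_(j+2) with fixed coefficients
      ([rigid_2k1]).
    - For n = 3k, c cannot vanish and f_j, f_(j+k), f_(j+2k) lie on an affine
      regular hexagon; expressing f_(j+1) in the basis f_j, f_(j+k) leaves one
      unknown, a root of a fixed quadratic equation.  Two different roots at
      consecutive indices would give f_(j+2) = -f_j, which the distinctness of
      vertices forbids, so the root is always the same ([rigid_3k]).

    For the non-trivial polygons, when n is even and k is odd, take a regular
    polygon and stretch the vertices of even index by 2 and those of odd index
    by 1/2: brackets between vertices of opposite parity do not change, while
    a_0 and a_1 become different ([nontrivial_even_odd]).

    When n = 2k, f_j and f_(j+k) are conjugate directions, as for a Radon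
    curve: the quarters f_0..f_k and f_k..f_(2k) determine each other, and a
    quarter turn of the pair (f_j, f_(j+k)) continues the polygon
    ([quarter_turn_extension]).  Write k = m+3.  The quarter starts with a
    circular arc of m steps of angle t, followed by three further steps that
    depend on a stretch factor u.  All conditions reduce to a single equation
    between t and u, linear in u + 1/u, and for 0 < t < pi/(2k) it has a
    solution u > 1 ([radon_parameters], [nontrivial_radon]).  For k = 3 the
    first construction applies, so m >= 1 suffices.

    In both constructions the vertices are distinct because the first n of
    them lie in the closed upper half plane and turn counterclockwise
    ([half_plane]). *)

(** * The bracket on the plane *)

Lemma row_mx_0 (R : Type) (u v : 'cV[R]_2) (i : 'I_2) :
  (row_mx u v : 'M[R]_2) i 0 = u i 0.
Proof.
by rewrite -(row_mxEl u v i 0); congr (fun_of_matrix _ _ _); apply: val_inj.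
Qed.

Lemma row_mx_1 (R : Type) (u v : 'cV[R]_2) (i : 'I_2) :
  (row_mx u v : 'M[R]_2) i 1 = v i 0.
Proof.
by rewrite -(row_mxEr u v i 0); congr (fun_of_matrix _ _ _); apply: val_inj.
Qed.

Lemma det_mx22 (R : comNzRingType) (M : 'M[R]_2) :
  \det M = M 0 0 * M 1 1 - M 1 0 * M 0 1.
Proof.
rewrite (expand_det_row _ 0) !big_ord_recl big_ord0 addr0.
rewrite /cofactor !det_mx11 !mxE.
rewrite [lift _ _](_ : _ = 1 :> 'I_2); last exact: val_inj.
rewrite [lift 1 0](_ : _ = 0 :> 'I_2); last exact: val_inj.
by rewrite expr0 expr1 mul1r mulN1r mulrN [M 1 0 * _]mulrC.
Qed.

Lemma bracketE (R : realType) (u v : 'cV[R]_2) :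
  bracket u v = u 0 0 * v 1 0 - u 1 0 * v 0 0.
Proof. by rewrite /bracket det_mx22 !row_mx_0 !row_mx_1. Qed.

Lemma cV2P (R : realType) (u v : 'cV[R]_2) :
  u 0 0 = v 0 0 -> u 1 0 = v 1 0 -> u = v.
Proof.
move=> h0 h1; apply/matrixP => i j; rewrite (ord1 j).
by case: i => [[|[|//]] hi]; [move: h0 | move: h1]; congr (_ = _);
  congr (fun_of_matrix _ _ _); apply: val_inj.
Qed.

Lemma mulmx_row2 (R : realType) (u v w : 'cV[R]_2) :
  (row_mx u v : 'M[R]_2) *m w = w 0 0 *: u + w 1 0 *: v.
Proof.
have e1 : lift ord0 ord0 = 1 :> 'I_2 by apply: val_inj.
by apply: cV2P; rewrite !mxE !big_ord_recl big_ord0 addr0 e1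
  row_mx_0 row_mx_1 mulrC [_ * w 1 0]mulrC.
Qed.

Lemma bracketvv (R : realType) (u : 'cV[R]_2) : bracket u u = 0.
Proof. by rewrite bracketE; ring. Qed.

Lemma bracketC (R : realType) (u v : 'cV[R]_2) : bracket u v = - bracket v u.
Proof. by rewrite !bracketE; ring. Qed.

Lemma bracketNr (R : realType) (u v : 'cV[R]_2) : bracket u (- v) = - bracket u v.
Proof. by rewrite !bracketE !mxE; ring. Qed.

Lemma bracketNl (R : realType) (u v : 'cV[R]_2) : bracket (- u) v = - bracket u v.
Proof. by rewrite !bracketE !mxE; ring. Qed.

Lemma bracketZl (R : realType) (a : R) (u v : 'cV[R]_2) :
  bracket (a *: u) v = a * bracket u v.
Proof. by rewrite !bracketE !mxE; ring. Qed.

Lemma bracketZr (R : realType) (a : R) (u v : 'cV[R]_2) :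
  bracket u (a *: v) = a * bracket u v.
Proof. by rewrite !bracketE !mxE; ring. Qed.

Lemma bracketDr (R : realType) (u v w : 'cV[R]_2) :
  bracket u (v + w) = bracket u v + bracket u w.
Proof. by rewrite !bracketE !mxE; ring. Qed.

Lemma bracketDl (R : realType) (u v w : 'cV[R]_2) :
  bracket (u + v) w = bracket u w + bracket v w.
Proof. by rewrite !bracketE !mxE; ring. Qed.

Lemma bracket_mulmx (R : realType) (A : 'M[R]_2) (u v : 'cV[R]_2) :
  bracket (A *m u) (A *m v) = \det A * bracket u v.
Proof. by rewrite /bracket -mul_mx_row det_mulmx. Qed.

(** Cramer's rule, free of division: the source of every linear relation
    between vertices below. *)
Lemma bracket_cramer (R : realType) (u v w : 'cV[R]_2) :
  bracket u v *: w = bracket w v *: u + bracket u w *: v.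
Proof. by apply: cV2P; rewrite !mxE !bracketE; ring. Qed.

(** * Vertex sequences and the discrete Hill equation *)

Definition unimodular (R : realType) (f : nat -> 'cV[R]_2) :=
  forall j, bracket (f j) (f j.+1) = 1.

Definition antiperiodic (R : realType) (n : nat) (f : nat -> 'cV[R]_2) :=
  forall j, f (j + n)%N = - f j.

(** The trace of distinctness of the vertices on an [n]-antiperiodic sequence:
    since [f (i + n) = - f i], an earlier antipode would be a repeated vertex. *)
Definition no_early_antipode (R : realType) (n : nat) (f : nat -> 'cV[R]_2) :=
  forall i d, (0 < d < n)%N -> f (i + d)%N <> - f i.

(** Cramer's rule with unimodular consecutive terms: the discrete Hill equation. *)
Lemma three_term (R : realType) (f : nat -> 'cV[R]_2) : unimodular f ->
  forall j, f j.+2 = bracket (f j) (f j.+2) *: f j.+1 - f j.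
Proof.
move=> f1 j; have := bracket_cramer (f j) (f j.+1) (f j.+2).
by rewrite f1 scale1r [bracket _ (f j.+1)]bracketC f1 scaleN1r addrC.
Qed.

(** For unimodular [f], the bracket of [f j] and [f j.+2] is the coefficient at
    [j] of the Hill equation. *)
Definition constant_hill (R : realType) (f : nat -> 'cV[R]_2) :=
  exists a, forall j, bracket (f j) (f j.+2) = a.

Lemma backlund_seq (R : realType) (n k : nat) (P : 'Z_(2 * n) -> 'cV[R]_2) :
  (0 < n)%N -> self_backlund k P ->
  [/\ unimodular (fun j => P j%:R), antiperiodic n (fun j => P j%:R),
      no_early_antipode n (fun j => P j%:R) &
      exists c, forall j, bracket (P j%:R) (P (j + k)%N%:R) = c].
Proof.
move=> n0 [injP Ps P1 [c Pc]]; split.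
- by move=> j; rewrite -natr1 P1.
- by move=> j; rewrite natrD Ps.
- move=> i d /andP[d0 dn]; rewrite -Ps => /injP; rewrite natrD => /addrI.
  have n2 : (1 < 2 * n)%N by lia.
  move=> /(congr1 (@nat_of_ord _)).
  rewrite (val_Zp_nat n2 d) (val_Zp_nat n2 n) !modn_small; lia.
- by exists c => j; rewrite natrD Pc.
Qed.

(** * Rigidity: the Hill coefficient is constant *)

(** The product of consecutive coefficients is [c + 1], so the coefficients are
    2-periodic as soon as none of them vanishes, and a zero coefficient means
    [f j.+2 = - f j].  With an odd period 2-periodicity is constancy. *)
Lemma rigid_odd3 (R : realType) (n : nat) (c : R) (f : nat -> 'cV[R]_2) :
  (2 < n)%N -> odd n -> unimodular f -> antiperiodic n f -> no_early_antipode n f ->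
  (forall j, bracket (f j) (f (j + 3)%N) = c) -> constant_hill f.
Proof.
move=> n2 n_odd f1 fn fP fc; set a := fun j => bracket (f j) (f j.+2).
have a0 j : a j != 0.
  apply/eqP => aj; apply: (fP j 2); first by rewrite n2.
  by rewrite addn2 (three_term f1) -/(a j) aj scale0r sub0r.
have aa j : a j.+1 * a j = c + 1.
  rewrite -(fc j) addn3 (three_term f1 j.+1) -/(a j.+1).
  by rewrite bracketDr bracketZr bracketNr f1 -/(a j); ring.
have a2 j : a j.+2 = a j.
  by apply: (mulfI (a0 j.+1)); rewrite [LHS]mulrC aa [RHS]aa.
have an j : a (j + n)%N = a j by rewrite /a -!addSn !fn bracketNl bracketNr opprK.
have aD j m : a (j + m.*2)%N = a j.
  by elim: m => [|m IH]; rewrite ?addn0 // doubleS !addnS a2.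
exists (a 0); elim=> [//|j IH].
rewrite -[LHS]/(a j.+1) -IH -[RHS]/(a j) -(an j) -(aD j.+1 n./2) addSn -addnS.
by congr (a (j + _)%N); rewrite -[n in RHS]odd_double_half n_odd.
Qed.

(** Antiperiodicity turns the diagonal condition into two facts about
    [f (i + k).+1]: its brackets with [f i] and [f i.+1] are both known.  Hence
    the shift by [k + 1] acts as [c] times the difference operator, and its
    square is, up to sign, the shift by one. *)
Lemma rigid_2k1 (R : realType) (k : nat) (c : R) (f : nat -> 'cV[R]_2) :
  unimodular f -> antiperiodic (2 * k + 1) f ->
  (forall j, bracket (f j) (f (j + k)%N) = c) -> constant_hill f.
Proof.
move=> f1 fn fc.
have fD i : f (i + k).+1 = c *: (f i.+1 - f i).
  have := bracket_cramer (f i) (f i.+1) (f (i + k).+1).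
  rewrite f1 scale1r bracketC -addSn fc => ->.
  have -> : bracket (f i) (f (i.+1 + k)%N) = c.
    rewrite -(fc (i.+1 + k)%N).
    have -> : (i.+1 + k + k = i + (2 * k + 1))%N by lia.
    by rewrite fn bracketNr bracketC.
  by apply: cV2P; rewrite !mxE; ring.
have E i : c ^+ 2 * (bracket (f i) (f i.+2) - 2) = -1.
  have H : - f i.+1 = c ^+ 2 *: (f i.+2 - 2 *: f i.+1 + f i).
    rewrite -fn [(_ + _)%N](_ : _ = ((i + k).+1 + k).+1); last by lia.
    rewrite fD -addSn !fD.
    by apply: cV2P; rewrite !mxE; ring.
  have := congr1 (bracket (f i)) H.
  rewrite bracketNr bracketZr !bracketDr bracketNr bracketZr f1 bracketvv => ->.
  by ring.
have c0 : c != 0 by apply/eqP => c0; move: (E 0); rewrite c0; lra.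
exists (2 - (c ^+ 2)^-1) => j; apply: (mulfI (expf_neq0 2 c0)).
rewrite mulrBr divff ?expf_neq0 //; move: (E j); lra.
Qed.

(** If [c = 0], then [f (i + k) = l_i f i] with [l_i l_(i+1) = 1], and three
    shifts by [k] give [l_i l_(i+k) l_(i+2k) = -1]; either parity of [k] yields [l_i = -1], an early antipode.  If [c] is nonzero,
    [q i = [f (i+1), f (i+k)]] is the coordinate of [c f (i+1)] along [f i] and
    is a root of [q^2 + q + 1 = c^2].  The two roots add up to [-1], and a jump
    from one to the other forces [f (i+2) = - f i]. *)
Lemma rigid_3k (R : realType) (k : nat) (c : R) (f : nat -> 'cV[R]_2) :
  (0 < k)%N -> unimodular f -> antiperiodic (3 * k) f -> no_early_antipode (3 * k) f ->
  (forall j, bracket (f j) (f (j + k)%N) = c) -> constant_hill f.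
Proof.
move=> k0 f1 fn fP fc.
have f3 i : f (i + k + k + k)%N = - f i by rewrite -fn; congr f; lia.
have [c0|c0] := eqVneq c 0.
  (* Bracketing [f (i + k)] with [f i.+1] reads off the factor of proportionality. *)
  set l := fun i => bracket (f (i + k)%N) (f i.+1).
  have fl i : f (i + k)%N = l i *: f i.
    have := bracket_cramer (f i) (f i.+1) (f (i + k)%N).
    by rewrite f1 fc c0 scale1r scale0r addr0.
  have ll i : l i * l i.+1 = 1.
    have := f1 (i + k)%N.
    by rewrite -addSn !fl bracketZl bracketZr f1 mulr1.
  have l3 i : l i * l (i + k)%N * l (i + k + k)%N = -1.
    have := f3 i; rewrite !fl !scalerA => /(congr1 (fun u => bracket u (f i.+1))).
    by rewrite bracketZl bracketNl f1 mulr1 => <-; ring.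
  have l0 i : l i != 0.
    by apply/eqP => li; move: (ll i); rewrite li mul0r => /eqP; rewrite eq_sym oner_eq0.
  have l2 i : l i.+2 = l i.
    by apply: (mulfI (l0 i.+1)); rewrite ll mulrC ll.
  have lD i m : l (i + m.*2)%N = l i.
    by elim: m => [|m IH]; rewrite ?addn0 // doubleS !addnS l2.
  have lk2 i : l (i + k + k)%N = l i by rewrite -addnA addnn lD.
  have lN : l 0 = -1.
    have := l3 0; rewrite lk2 add0n -[k]odd_double_half.
    case: (odd k) => /=; rewrite ?add0n.
      by rewrite lD ll mul1r.
    rewrite -[k./2.*2]add0n lD => H.
    have /eqP : (l 0 + 1) * ((l 0) ^+ 2 - l 0 + 1) = 0.
      by transitivity (l 0 * l 0 * l 0 + 1); [ring | rewrite H; ring].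
    rewrite mulf_eq0 => /orP [/eqP|/eqP]; first by lra.
    by nra.
  exfalso; apply: (fP 0 k); first by lia.
  by rewrite fl lN scaleN1r.
set q := fun i => bracket (f i.+1) (f (i + k)%N).
have cf i : c *: f i.+1 = q i *: f i + f (i + k)%N.
  have := bracket_cramer (f i) (f (i + k)%N) (f i.+1).
  by rewrite fc f1 scale1r.
have f02 i : bracket (f i) (f (i + k + k)%N) = c.
  by rewrite -(fc (i + k + k)%N) f3 bracketNr bracketC.
have fz i : f (i + k + k)%N = f (i + k)%N - f i.
  apply: (scalerI c0); have := bracket_cramer (f i) (f (i + k)%N) (f (i + k + k)%N).
  rewrite fc f02 bracketC fc => ->.
  by apply: cV2P; rewrite !mxE; ring.
(* Unimodularity at [i + 2k], where [f (i + 2k) = f (i + k) - f i]. *)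
have qw i : bracket (f i) (f (i.+1 + k)%N) = 1 + q i.
  have := f1 (i + k + k)%N; rewrite -!addSn !fz.
  rewrite !bracketDl !bracketDr !bracketNl !bracketNr f1 addSn f1.
  rewrite [bracket (f (i + k)%N) (f i.+1)]bracketC -/(q i); lra.
have cw i : c *: f (i.+1 + k)%N = - f i + (1 + q i) *: f (i + k)%N.
  have := bracket_cramer (f i) (f (i + k)%N) (f (i.+1 + k)%N).
  by rewrite fc qw bracketC addSn f1 scaleN1r.
have qq i : q i ^+ 2 + q i + 1 = c ^+ 2.
  have := congr1 (fun u => c * bracket u (f (i.+1 + k)%N)) (cf i).
  rewrite bracketZl fc -bracketZr cw.
  rewrite !bracketDl !bracketDr !bracketZl !bracketZr !bracketNr !bracketvv.
  rewrite [bracket (f (i + k)%N) _]bracketC fc => H.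
  by apply: (mulIf c0); rewrite -[RHS]mulrA H; ring.
have c2f i : c ^+ 2 *: f i.+2 =
    (q i.+1 * q i - 1) *: f i + (q i.+1 + q i + 1) *: f (i + k)%N.
  rewrite expr2 -scalerA cf scalerDr cw scalerA mulrC -scalerA cf.
  by apply: cV2P; rewrite !mxE; ring.
have qS i : q i.+1 = q i.
  have /eqP : (q i.+1 - q i) * (q i.+1 + q i + 1) = 0.
    by transitivity ((q i.+1 ^+ 2 + q i.+1 + 1) - (q i ^+ 2 + q i + 1));
      [ring | rewrite !qq subrr].
  rewrite mulf_eq0 => /orP [/eqP|/eqP H]; first by lra.
  exfalso; apply: (fP i 2); first by lia.
  apply: (scalerI (expf_neq0 2 c0)); rewrite addn2 c2f H scale0r addr0 scalerN.
  rewrite -scaleNr; congr (_ *: _); rewrite -(qq i).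
  by rewrite (_ : q i.+1 = - q i - 1); [ring | lra].
exists ((q 0 + q 0 + 1) / c) => j.
have q0 : q j = q 0 by elim: j => // j IH; rewrite qS.
apply: (mulfI (expf_neq0 2 c0)); rewrite -bracketZr c2f bracketDr !bracketZr.
rewrite bracketvv fc qS q0; field; exact: c0.
Qed.

(** * Constant coefficient implies trivial *)

Lemma sin_eq0_nat (R : realType) (x : R) : 0 <= x -> sin x = 0 ->
  exists m : nat, x = m%:R * pi.
Proof.
move=> x0 sx; have pi0 := @pi_gt0 R.
have /truncn_itv /andP[hl hu] : 0 <= x / pi by rewrite divr_ge0 ?pi_ge0.
set m := Num.truncn _ in hl hu; exists m; apply/eqP; rewrite eq_le.
move: hl; rewrite ler_pdivlMr // => hl; rewrite hl andbT leNgt; apply/negP => lt.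
move: hu; rewrite ltr_pdivrMr // -natr1 => hu.
have : 0 < sin (x - m%:R * pi) by apply: sin_gt0_pi; lra.
have sm : sin (m%:R * pi) = 0 :> R.
  elim: m {hl lt hu} => [|m IH]; first by rewrite mul0r sin0.
  by rewrite -natr1 mulrDl mul1r sinDpi IH oppr0.
by rewrite sinB sx sm mul0r mulr0 subr0 ltxx.
Qed.

(** If [|a| >= 2], the recurrence makes [|[f 0, f j]|] strictly increasing in
    [j], whereas it vanishes at both [0] and [n]. *)
Lemma hill_coefficient_lt2 (R : realType) (a : R) (n : nat) (f : nat -> 'cV[R]_2) :
  (0 < n)%N -> unimodular f -> antiperiodic n f ->
  (forall j, bracket (f j) (f j.+2) = a) -> `|a| < 2.
Proof.
move=> n0 f1 fn fa; rewrite ltNge; apply/negP => a2.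
set d := fun j => `|bracket (f 0) (f j)|.
have dS j : d j < d j.+1.
  elim: j => [|j IH]; first by rewrite /d bracketvv f1 normr0 normr1.
  have H : `|a| * d j.+1 <= d j.+2 + d j.
    rewrite -normrM -[_ * _](subrK (bracket (f 0) (f j))).
    apply: le_trans (ler_normD _ _) _; rewrite lerD2r.
    by rewrite /d (three_term f1) fa bracketDr bracketZr bracketNr.
  have : 2 * d j.+1 <= `|a| * d j.+1 by rewrite ler_wpM2r ?normr_ge0.
  by lra.
have := dS n.-1; rewrite prednK // {2}/d -[n]add0n fn bracketNr bracketvv oppr0.
by rewrite normr0 ltNge normr_ge0.
Qed.

(** Both sides solve the recurrence [x_(j+2) = 2 cos theta x_(j+1) - x_j] with
    the same first two terms. *)
Lemma constant_hill_rotation (R : realType) (theta : R) (f : nat -> 'cV[R]_2) :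
  sin theta != 0 -> unimodular f ->
  (forall j, bracket (f j) (f j.+2) = 2 * cos theta) ->
  forall j, f j = cos (j%:R * theta) *: f 0 +
    sin (j%:R * theta) *: ((sin theta)^-1 *: (f 1%N - cos theta *: f 0)).
Proof.
move=> st f1 fa.
pose g := fun j => cos (j%:R * theta) *: f 0 +
    sin (j%:R * theta) *: ((sin theta)^-1 *: (f 1%N - cos theta *: f 0)).
have g2 j : g j.+2 = (2 * cos theta) *: g j.+1 - g j.
  have tS i : i.+1%:R * theta = i%:R * theta + theta.
    by rewrite -natr1 mulrDl mul1r.
  rewrite /g !tS.
  rewrite !(cosD _ theta, sinD _ theta).
  have := cos2Dsin2 theta; move: (cos theta) (sin theta) => c s cs.
  move: (cos _) (sin _) (s^-1 *: _) => C S w.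
  have E x y : ((C * c - S * s) * c - (S * c + C * s) * s) * x +
      ((S * c + C * s) * c + (C * c - S * s) * s) * y =
      2 * c * ((C * c - S * s) * x + (S * c + C * s) * y) - (C * x + S * y).
    transitivity (2 * c * ((C * c - S * s) * x + (S * c + C * s) * y) -
      (c ^+ 2 + s ^+ 2) * (C * x + S * y)); first by ring.
    by rewrite cs mul1r.
  by apply: cV2P; rewrite !mxE E; ring.
suff H j : f j = g j /\ f j.+1 = g j.+1 by move=> j; case: (H j).
elim: j => [|j [IH1 IH2]]; last by rewrite IH2 (three_term f1) fa IH1 IH2 g2.
rewrite /g mul0r cos0 sin0 scale0r scale1r addr0 mul1r; split=> //.
by rewrite [in RHS]scalerA divff // scale1r addrCA subrr addr0.
Qed.

(** The angle [t] with [a = 2 cos t] is a multiple [m pi / n] because [f n] and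
    [f 0] are parallel; a common factor [d] of [m] and [2n] would make the
    vertices repeat with period [2n / d].  Taking [t] in [(0, pi)] makes [sin t]
    positive, so that the linear map can be normalised to determinant one. *)
Lemma trivial_of_constant_hill (R : realType) (n : nat) (P : 'Z_(2 * n) -> 'cV[R]_2) :
  (0 < n)%N -> injective P ->
  unimodular (fun j => P j%:R) -> antiperiodic n (fun j => P j%:R) ->
  constant_hill (fun j => P j%:R) -> trivial_polygon P.
Proof.
move=> n0 injP; set f := fun j : nat => P j%:R; move=> f1 fn [a fa].
have n21 : (1 < 2 * n)%N by lia.
have := hill_coefficient_lt2 n0 f1 fn fa; rewrite ltr_norml => a2.
have a1 : -1 <= a / 2 <= 1 by lra.
set t := acos (a / 2).
have ct : cos t = a / 2 by rewrite acosK.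
have t0 : 0 < t by apply: acos_gt0; lra.
have tpi : t < pi by apply: acos_ltpi; lra.
have st : 0 < sin t by apply: sin_gt0_pi; rewrite t0.
have fa2 j : bracket (f j) (f j.+2) = 2 * cos t by rewrite fa ct; lra.
have fE := constant_hill_rotation (lt0r_neq0 st) f1 fa2.
set w := (sin t)^-1 *: (f 1%N - cos t *: f 0) in fE.
have fw : bracket (f 0) w = (sin t)^-1.
  by rewrite bracketZr bracketDr bracketNr bracketZr f1 bracketvv; ring.
have fw0 : bracket (f 0) w != 0 by rewrite fw invr_eq0 lt0r_neq0.
clearbody w.
have [m tm] : exists m : nat, n%:R * t = m%:R * pi.
  apply: sin_eq0_nat; first by rewrite mulr_ge0 // ltW.
  have : f n = - f 0 by exact: (fn 0).
  rewrite fE => /(congr1 (bracket (f 0))).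
  rewrite bracketDr !bracketZr bracketNr bracketvv mulr0 add0r oppr0.
  by move=> /eqP; rewrite mulf_eq0 (negbTE fw0) orbF => /eqP.
have nR : n%:R != 0 :> R by rewrite pnatr_eq0 -lt0n.
have tE : t = m%:R * (2 * pi / (2 * n)%N%:R).
  by apply: (mulfI nR); rewrite tm natrM; field.
have cop : coprime m (2 * n).
  have [d1|] := leqP (gcdn m (2 * n)) 1.
    by rewrite /coprime eqn_leq d1 gcdn_gt0 muln_gt0 n0 orbT.
  set d := gcdn _ _ => d1; exfalso.
  have /dvdnP[m' mE] : (d %| m)%N by apply: dvdn_gcdl.
  have /dvdnP[e eE] : (d %| 2 * n)%N by apply: dvdn_gcdr.
  clearbody d.
  have et : e%:R * t = (pi *+ 2) *+ m'.
    have d0 : d%:R != 0 :> R by rewrite pnatr_eq0; lia.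
    apply: (mulfI d0); transitivity (2%:R * (n%:R * t)).
      by rewrite !mulrA -!natrM [(d * e)%N]mulnC -eE.
    by rewrite tm mE natrM -(mulr_natr _ m') -(mulr_natr pi 2); ring.
  have : f e = f 0.
    rewrite fE et -[_ *+ m']add0r (periodicn (@cosD2pi R)) (periodicn (@sinD2pi R)).
    by rewrite cos0 sin0 scale0r scale1r addr0.
  move=> /injP /(congr1 (@nat_of_ord _)).
  rewrite (val_Zp_nat n21 e) (val_Zp_nat n21 0) mod0n => /eqP.
  by rewrite -/(dvdn _ _) => /dvdn_leq; nia.
set r := (Num.sqrt (sin t))^-1.
have r0 : 0 < r by rewrite invr_gt0 sqrtr_gt0.
have rr : r * r = (sin t)^-1.
  by rewrite -invfM -expr2 sqr_sqrtr // ltW.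
set A : 'M[R]_2 := row_mx (r^-1 *: f 0 : 'cV_2) (r^-1 *: w : 'cV_2).
have dA : \det A = 1.
  rewrite -[\det A]/(bracket (r^-1 *: f 0) (r^-1 *: w)) bracketZl bracketZr fw -rr.
  by field; rewrite lt0r_neq0.
set Q : 'Z_(2 * n) -> 'cV[R]_2 := fun i => 
  \col_(j < 2) (r * (if j == 0 then cos (i%:R * t) else sin (i%:R * t))).
have PQ i : P i = A *m Q i.
  rewrite -[i in LHS]natr_Zp -/(f i) fE /A.
  rewrite mulmx_row2 !mxE /= !scalerA.
  by rewrite ![_ * _ * r^-1]mulrAC divff ?mul1r // lt0r_neq0.
exists A, Q; split=> //.
- exists r, 0, m; split=> // i /=.
  rewrite /Q; apply/matrixP => j l; rewrite !mxE add0r natrM.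
  by rewrite {1 2}tE -!mulrA ![m%:R * (_ * _)]mulrCA.
- move=> i; rewrite -[LHS]mul1r -dA -bracket_mulmx -!PQ.
  by rewrite -[i]natr_Zp natr1 f1.
Qed.

(** * Building polygons from sequences *)

Definition cvec (R : realType) (x y : R) : 'cV[R]_2 :=
  \col_(i < 2) (if i == 0 then x else y).

Lemma cvec0 (R : realType) (x y : R) : cvec x y 0 0 = x.
Proof. by rewrite mxE. Qed.

Lemma cvec1 (R : realType) (x y : R) : cvec x y 1 0 = y.
Proof. by rewrite mxE. Qed.

Lemma bracket_cvec (R : realType) (x y z t : R) :
  bracket (cvec x y) (cvec z t) = x * t - y * z.
Proof. by rewrite bracketE !cvec0 !cvec1. Qed.

(** In the open upper half plane the relation [0 < bracket u v] is transitive,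
    by the identity [E] below, which is the second coordinate of Cramer's rule;
    the argument survives if one of the two end points is on the axis.
    Antiperiodicity moves any pair at distance less than [n] into the window
    [0..n], whose end points are the only vertices there on the axis. *)
Lemma half_plane (R : realType) (n : nat) (F : nat -> 'cV[R]_2) :
  antiperiodic n F -> F 0 1 0 = 0 -> (forall j, (0 < j < n)%N -> 0 < F j 1 0) ->
  (forall j, 0 < bracket (F j) (F j.+1)) ->
  forall i d, (0 < d < n)%N -> 0 < bracket (F i) (F (i + d)%N).
Proof.
move=> Fn F0 Fy F1.
have yn : F n 1 0 = 0 by rewrite -[n]add0n Fn mxE F0 oppr0.
have y0 j : (j <= n)%N -> 0 <= F j 1 0.
  case: j => [|j]; first by rewrite F0.
  rewrite leq_eqVlt => /orP[/eqP->|jn]; first by rewrite yn.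
  by apply/ltW/Fy.
have base d i : (0 < d < n)%N -> (i + d <= n)%N -> 0 < bracket (F i) (F (i + d)%N).
  elim: d => [//|[|d] IH] dn le_n; first by rewrite addn1.
  have {}IH : 0 < bracket (F i) (F (i + d.+1)%N) by apply: IH; lia.
  rewrite (addnS i d.+1); set j := (i + d.+1)%N in IH *.
  have yj : 0 < F j 1 0 by apply: Fy; lia.
  have E : F j 1 0 * bracket (F i) (F j.+1) =
      F j.+1 1 0 * bracket (F i) (F j) + F i 1 0 * bracket (F j) (F j.+1).
    by rewrite !bracketE; ring.
  rewrite -(pmulr_rgt0 _ yj) E.
  have := F1 j; have := y0 i; have := y0 j.+1.
  have [i0|i0] := posnP i.
    have : 0 < F j.+1 1 0 by apply: Fy; lia.
    by move=> *; rewrite [F i 1 0](_ : _ = 0) ?mul0r ?addr0 ?mulr_gt0 // i0.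
  have : 0 < F i 1 0 by apply: Fy; lia.
  move=> yi yj1 _ b; apply: ltr_wpDl; last exact: mulr_gt0.
  by apply: mulr_ge0; [apply: yj1; lia | exact: ltW].
move=> i d dn.
have n0 : (0 < n)%N by lia.
elim/ltn_ind: i => i IH.
have [ni|ni] := leqP n i.
  rewrite -(subnK ni) addnAC !Fn bracketNl bracketNr opprK.
  by apply: IH; lia.
have [le|gt] := leqP (i + d) n; first exact: base.
have -> : (i + d = (i + d - n) + n)%N by lia.
rewrite Fn bracketNr bracketC opprK.
have := base (n - d)%N (i + d - n)%N.
have -> : (i + d - n + (n - d) = i)%N by lia.
by apply; lia.
Qed.

(** Vertices with a nonzero bracket are distinct, and [half_plane] makes the
    bracket nonzero for every pair except opposite vertices. *)
Lemma backlund_of_seq (R : realType) (n k : nat) (c : R) (F : nat -> 'cV[R]_2) :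
  (1 < n)%N -> antiperiodic n F -> F 0 1 0 = 0 ->
  (forall j, (0 < j < n)%N -> 0 < F j 1 0) -> unimodular F ->
  (forall j, bracket (F j) (F (j + k)%N) = c) ->
  exists P : 'Z_(2 * n) -> 'cV[R]_2,
    self_backlund k P /\ forall j : nat, P j%:R = F j.
Proof.
move=> n1 Fn F0 Fy F1 Fc; pose P (i : 'Z_(2 * n)) := F i.
have F2 j q : F (j + q * (2 * n))%N = F j.
  elim: q => [|q IH]; first by rewrite addn0.
  rewrite -[RHS]IH (_ : (j + q.+1 * (2 * n) = j + q * (2 * n) + n + n)%N); last by lia.
  by rewrite !Fn opprK.
have PF (j : nat) : P j%:R = F j.
  rewrite /P val_Zp_nat; last by lia.
  by rewrite [in RHS](divn_eq j (2 * n)) addnC F2.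
have pos := half_plane Fn F0 Fy (fun j => eq_ind_r (fun x => 0 < x) (@ltr01 R) (F1 j)).
have inj_lt (i j : nat) : (i < j)%N -> (j < 2 * n)%N -> F i = F j -> False.
  move=> ij j2 E; have [lt|gt|eq] := ltngtP (j - i) n.
  - have := pos i (j - i)%N; rewrite subnKC ?(ltnW ij) // E bracketvv ltxx.
    by move=> H; suff: false by []; apply: H; lia.
  - have := pos i (j - i - n)%N.
    rewrite E [in F j](_ : j = i + (j - i - n) + n)%N; last by lia.
    rewrite Fn bracketNl bracketvv oppr0 ltxx.
    by move=> H; suff: false by []; apply: H; lia.
  - have jE : j = (i + n)%N by lia.
    move: E (F1 i); rewrite jE Fn => E; rewrite bracketE.
    have [-> ->] : F i 0 0 = 0 /\ F i 1 0 = 0.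
      have := congr1 (fun u : 'cV[R]_2 => u 0 0) E.
      have := congr1 (fun u : 'cV[R]_2 => u 1 0) E.
      by rewrite !mxE; split; lra.
    by rewrite !mul0r subr0 => /eqP; rewrite eq_sym oner_eq0.
have szZ : ((Zp_trunc (2 * n)).+2 = 2 * n)%N by rewrite Zp_cast //; lia.
exists P; split=> //; split.
- move=> i j E; apply: val_inj => /=.
  have iN : (i < 2 * n)%N by rewrite -[X in (_ < X)%N]szZ ltn_ord.
  have jN : (j < 2 * n)%N by rewrite -[X in (_ < X)%N]szZ ltn_ord.
  have [lt|gt|//] := ltngtP (i : nat) (j : nat).
    by case: (inj_lt _ _ lt jN E).
  by case: (inj_lt _ _ gt iN (esym E)).
- by move=> i; rewrite -[i]natr_Zp -natrD !PF Fn.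
- by move=> i; rewrite -[i]natr_Zp natr1 !PF F1.
- by exists c => i; rewrite -[i]natr_Zp -natrD !PF Fc.
Qed.

(** The bound on [j] keeps [j] and [j.+2] within one turn, where residues are
    the numbers themselves. *)
Lemma constant_hill_of_trivial (R : realType) (n : nat) (P : 'Z_(2 * n) -> 'cV[R]_2) :
  (1 < n)%N -> trivial_polygon P ->
  exists g, forall j, (j.+2 < 2 * n)%N -> bracket (P j%:R) (P j.+2%:R) = g.
Proof.
move=> n1 [A [Q [dA [r [phi [m [r0 _ QE]]]] _ PE]]].
pose d : R := 2 * pi / (2 * n)%N%:R.
exists (r ^+ 2 * sin ((m * 2)%N%:R * d)) => j jn.
have n2 : (1 < 2 * n)%N by lia.
have val i : (i < 2 * n)%N -> nat_of_ord (i%:R : 'Z_(2 * n)) = i.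
  by move=> i2; rewrite (val_Zp_nat n2 i) modn_small.
rewrite !PE bracket_mulmx dA mul1r !QE -/d (val j) ?(val j.+2) //; last by lia.
rewrite bracketE !mxE /=.
rewrite [sin _ in RHS](_ : _ = sin ((phi + (m * j.+2)%:R * d) - (phi + (m * j)%:R * d))).
  by rewrite sinB; ring.
by congr sin; rewrite -addn2 mulnDr natrD; ring.
Qed.

(** * Non-trivial polygons *)

(** Stretching a regular polygon by [2] at even and [1/2] at odd indices keeps
    all brackets at odd distance; [n] must be even for the result to be
    symmetric about the origin. *)
Lemma nontrivial_even_odd (R : realType) (n k : nat) :
  (3 < n)%N -> ~~ odd n -> odd k ->
  exists P : 'Z_(2 * n) -> 'cV[R]_2, self_backlund k P /\ ~ trivial_polygon P.
Proof.
move=> n3 n_even k_odd.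
have pi0 := @pi_gt0 R.
have nR : 3 < n%:R :> R by rewrite (ltr_nat R 3).
pose a : R := pi / n%:R.
have na : n%:R * a = pi by rewrite mulrC divfK // lt0r_neq0 //; lra.
have a0 : 0 < a by rewrite divr_gt0 //; lra.
have ja j : (0 < j < n)%N -> 0 < j%:R * a < pi.
  move=> /andP[j0 jn]; rewrite mulr_gt0 ?ltr0n //= -na.
  by rewrite ltr_pM2r // ltr_nat.
have sja j : (0 < j < n)%N -> 0 < sin (j%:R * a) by move=> /ja/sin_gt0_pi.
have s1 : 0 < sin a by rewrite -[a]mul1r; apply: (sja 1%N); lia.
pose r : R := (Num.sqrt (sin a))^-1.
have r0 : 0 < r by rewrite invr_gt0 sqrtr_gt0.
have rr : r * r * sin a = 1.
  by rewrite -invfM -expr2 sqr_sqrtr ?mulVf ?ltW ?lt0r_neq0.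
pose s (j : nat) : R := if odd j then 2^-1 else 2.
have s_gt0 j : 0 < s j by rewrite /s; case: (odd j); lra.
pose F (j : nat) := (r * s j) *: cvec (cos (j%:R * a)) (sin (j%:R * a)).
have FF i d : bracket (F i) (F (i + d)%N) = r * r * (s i * s (i + d)%N) * sin (d%:R * a).
  rewrite bracketZl bracketZr bracket_cvec.
  rewrite (_ : d%:R * a = (i + d)%N%:R * a - i%:R * a); last by rewrite natrD; ring.
  by rewrite sinB; ring.
have ss i d : odd d -> s i * s (i + d)%N = 1.
  by rewrite /s oddD => ->; case: (odd i) => /=; field.
have [||||j|j|P [PB PF]] := @backlund_of_seq R n k (r * r * sin (k%:R * a)) F.
- by lia.
- move=> j; rewrite /F natrD mulrDl na sinDpi cosDpi /s oddD (negbTE n_even) addbF.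
  by apply: cV2P; rewrite !mxE /=; ring.
- by rewrite mxE cvec1 mul0r sin0 mulr0.
- move=> j jn; rewrite mxE cvec1; apply: mulr_gt0; last exact: sja.
  exact: mulr_gt0.
- by rewrite -addn1 FF ss // mulr1 mul1r.
- by rewrite FF ss // mulr1.
exists P; split=> // /(constant_hill_of_trivial (ltnW (ltnW n3))) [g Hg].
have := Hg 0 ltac:(lia); rewrite -(Hg 1%N) ?PF; last by lia.
rewrite -[2%N]/(0 + 2)%N -[3%N]/(1 + 2)%N !FF /s /=.
move=> E; have := mulr_gt0 (mulr_gt0 r0 r0) (sja 2%N ltac:(lia)).
by move: E; set X := sin _; lra.
Qed.

(** [V] and [W] are two adjacent quarters of the polygon, closing up as
    [V k = W 0] and [W k = - V 0].  The pair of conjugate vertices is continued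
    by [(v, w) |-> (w, - v)], which preserves both the bracket of the pair and
    the brackets of consecutive vertices. *)
Lemma quarter_turn_extension (R : realType) (k : nat) (sg dl : R) (V W : nat -> 'cV[R]_2) :
  (0 < k)%N -> V k = W 0 -> W k = - V 0 ->
  (forall j, (j < k)%N -> bracket (V j) (V j.+1) = sg) ->
  (forall j, (j < k)%N -> bracket (W j) (W j.+1) = sg) ->
  (forall j, (j < k)%N -> bracket (V j) (W j) = dl) ->
  exists F : nat -> 'cV[R]_2,
    [/\ antiperiodic (2 * k) F, forall j, bracket (F j) (F j.+1) = sg,
        forall j, bracket (F j) (F (j + k)%N) = dl,
        forall j, (j < k)%N -> F j = V j &
        forall j, (j < k)%N -> F (j + k)%N = W j].
Proof.
move=> k0 Vk Wk V1 W1 VW.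
pose T (p : 'cV[R]_2 * 'cV[R]_2) := (p.2, - p.1).
pose G j := iter (j %/ k) T (V (j %% k)%N, W (j %% k)%N).
have GD j : G (j + k)%N = T (G j) by rewrite /G divnDr // divnn k0 addn1 modnDr.
have Gk j : (j < k)%N -> G j = (V j, W j) by move=> jk; rewrite /G divn_small ?modn_small.
have GS j : bracket (G j).1 (G j.+1).1 = sg /\ bracket (G j).2 (G j.+1).2 = sg.
  elim/ltn_ind: j => j IH; have [kj|jk] := leqP k j.
    rewrite -(subnK kj) -addSn !GD /= bracketNl bracketNr opprK.
    by case: (IH (j - k)%N) => [|-> ->]; first by lia.
  rewrite (Gk j jk) /=; move: (jk); rewrite leq_eqVlt => /orP[/eqP jk1|jk1].
    rewrite jk1 -[k]add0n GD (Gk 0) //= -Vk -Wk -jk1.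
    by rewrite V1 // W1.
  by rewrite (Gk _ jk1) /= V1 // W1.
have GVW j : bracket (G j).1 (G j).2 = dl.
  elim/ltn_ind: j => j IH; have [kj|jk] := leqP k j.
    by rewrite -(subnK kj) GD /= bracketNr bracketC opprK IH //; lia.
  by rewrite Gk //= VW.
exists (fun j => (G j).1); split=> j.
- by rewrite mul2n -addnn addnA !GD.
- by case: (GS j).
- by rewrite GD /= GVW.
- by move=> jk; rewrite Gk.
- by move=> jk; rewrite GD /= Gk.
Qed.

(** At [u = 1] the left-hand side of the equation is [cos ((m + 2) t)], which
    exceeds [sin t = cos (pi / 2 - t)] as soon as [(m + 3) t < pi / 2].  The
    left-hand side is affine and decreasing in [u + u^-1], so equality occurs
    for some [u > 1], the larger root of [u + u^-1 = 2 h].  The angle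
    [t = pi / (2 (m + 4))] is one admissible choice. *)
Lemma radon_parameters (R : realType) (m : nat) : (0 < m)%N ->
  exists t u : R, [/\ 0 < t, m.+3%:R * t < pi / 2, 1 < u &
    cos (m%:R * t) * (cos t ^+ 2 - sin t ^+ 2)
      - cos t * sin t * (u + u^-1) * sin (m%:R * t) = sin t].
Proof.
move=> m0; have pi0 := @pi_gt0 R.
have mR : 1 <= m%:R :> R by rewrite (ler_nat R 1).
pose t : R := pi / 2 / m.+4%:R.
have t0 : 0 < t by rewrite !divr_gt0.
have m4 : m%:R * t + 4 * t = pi / 2.
  by rewrite -mulrDl -natrD addn4 mulrC divfK // pnatr_eq0.
have mt : t <= m%:R * t by rewrite ler_peMl // ltW.
set x := m%:R * t in m4 mt *.
have C0 : 0 < cos t by apply: cos_gt0_pihalf; apply/andP; split; lra.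
have S0 : 0 < sin t by apply: sin_gt0_pihalf; apply/andP; split; lra.
have s0 : 0 < sin x by apply: sin_gt0_pihalf; apply/andP; split; lra.
pose D := 2 * (cos t * sin t * sin x).
have D0 : 0 < D by rewrite /D; do 3?apply: mulr_gt0.
pose h := (cos x * (cos t ^+ 2 - sin t ^+ 2) - sin t) / D.
have h1 : 1 < h.
  rewrite ltr_pdivlMr // mul1r.
  have : cos (pi / 2 - t) < cos (x + (t + t)).
    by rewrite ltr_cos ?in_itv /=; [lra | apply/andP; split; lra..].
  rewrite cosB cos_pihalf sin_pihalf cosD cosD sinD /D; lra.
pose q := Num.sqrt (h ^+ 2 - 1).
have h2 : 0 < h ^+ 2 - 1 by rewrite subr_gt0 expr_gt1 //; lra.
have q0 : 0 < q by rewrite sqrtr_gt0.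
have qq : q ^+ 2 = h ^+ 2 - 1 by rewrite sqr_sqrtr // ltW.
have uV : (h + q)^-1 = h - q.
  apply: (mulfI (lt0r_neq0 (addr_gt0 (lt_trans ltr01 h1) q0))).
  by rewrite divff ?lt0r_neq0 ?addr_gt0 ?(lt_trans ltr01 h1) // mulrC -subr_sqr qq; ring.
exists t, (h + q); split=> //; [|lra|].
  by rewrite -[m.+3]addn3 natrD mulrDl -/x; lra.
rewrite uV (_ : _ * (h + q + (h - q)) * _ = h * D); last by rewrite /D; ring.
by rewrite divfK ?lt0r_neq0 //; ring.
Qed.

(** With [k = m + 3], let [B p] have columns [(p C, S)] and [(-S, C / p)] for
    [C = cos t], [S = sin t]; it moves the pair [(V j, W j)] one step forward.
    The quarter consists of [m] rotations [B 1], then of [B u], [B x], [B u]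
    for some [x].  The vertices [m + 1] and [m + 2] are obtained by going one
    step forward from [m] and one step back from the end [(0, 1), (-1, 0)], so
    only the step between them is a condition; it is the equation of
    [radon_parameters].  Non-triviality is seen by comparing the Hill
    coefficients around the vertices [k] and [2 k], which are proportional to
    [1 + u^-1] and [1 + u]. *)
Lemma nontrivial_radon (R : realType) (m : nat) : (0 < m)%N ->
  exists P : 'Z_(2 * (2 * m.+3)) -> 'cV[R]_2,
    self_backlund m.+3 P /\ ~ trivial_polygon P.
Proof.
move=> m0.
have n1 : (1 < 2 * m.+3)%N by lia.
have lt1 : (m.+4 < 2 * (2 * m.+3))%N by lia.
have lt2 : ((m.+2 + m.+3).+2 < 2 * (2 * m.+3))%N by lia.
have [t [u [t0 m3 u1 E]]] := @radon_parameters R m m0.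
have pi0 := @pi_gt0 R; have u0 : 0 < u by lra.
have jt j : (j <= m)%N -> 0 <= j%:R * t /\ j%:R * t + 3 * t < pi / 2.
  move=> jm; split; first by rewrite mulr_ge0 // ltW.
  rewrite -mulrDl; apply: le_lt_trans m3; rewrite ler_pM2r //.
  by rewrite -natrD ler_nat; lia.
set C := cos t in E; set S := sin t in E.
set c := cos (m%:R * t) in E; set s := sin (m%:R * t) in E.
have tpi : 3 * t < pi / 2 by have := jt 0 isT; rewrite mul0r; lra.
have C0 : 0 < C by apply: cos_gt0_pihalf; apply/andP; split; lra.
have S0 : 0 < S by apply: sin_gt0_pihalf; apply/andP; split; lra.
have c0 : 0 < c by apply: cos_gt0_pihalf; have := jt m (leqnn m); lra.
have s0 : 0 < s.
  have : 0 < m%:R * t by rewrite mulr_gt0 // ltr0n.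
  by move=> ?; apply: sin_gt0_pihalf; have := jt m (leqnn m); lra.
have CS : C ^+ 2 + S ^+ 2 = 1 by exact: cos2Dsin2.
have cs : c ^+ 2 + s ^+ 2 = 1 by exact: cos2Dsin2.
pose v := u^-1; have uv : u * v = 1 by rewrite divff // lt0r_neq0.
have v0 : 0 < v by rewrite invr_gt0.
(* The second coordinate of [W m.+1]: the only one of the second quarter whose
   sign is not evident.  Multiply [E] by [c] and discard [(c S)^2]. *)
have key : 0 < c * C * v - s * S.
  have H : (s * S) * (u + v) < c * C.
    have H0 : (c * C) * ((s * S) * (u + v)) < (c * C) * (c * C).
      have := mulr_gt0 c0 S0; have : 0 < (c * S) ^+ 2 by rewrite exprn_gt0 ?mulr_gt0.
      have := congr1 (fun x => c * x) E; rewrite -/v; lra.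
    by rewrite ltr_pM2l ?mulr_gt0 in H0.
  have : v * ((s * S) * (u + v)) < v * (c * C) by rewrite ltr_pM2l.
  rewrite (_ : v * _ = s * S * (u * v) + s * S * v * v); last by ring.
  rewrite uv; have : 0 < s * S * v * v by rewrite !mulr_gt0.
  lra.
pose k := m.+3.
pose V j := if (j <= m)%N then cvec (cos (j%:R * t)) (sin (j%:R * t)) else
  if j == m.+1 then cvec (u * c * C - s * S) (u * s * C + c * S) else
  if j == m.+2 then cvec S (v * C) else cvec 0 1.
pose W j := if (j <= m)%N then cvec (- sin (j%:R * t)) (cos (j%:R * t)) else
  if j == m.+1 then cvec (- (c * S + v * s * C)) (v * c * C - s * S) else
  if j == m.+2 then cvec (- (u * C)) S else cvec (- 1) 0.
have tS j : j.+1%:R * t = j%:R * t + t by rewrite -natr1 mulrDl mul1r.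
have Vle j : (j <= m)%N -> V j = cvec (cos (j%:R * t)) (sin (j%:R * t)).
  by rewrite /V => ->.
have Wle j : (j <= m)%N -> W j = cvec (- sin (j%:R * t)) (cos (j%:R * t)).
  by rewrite /W => ->.
have V1 : V m.+1 = cvec (u * c * C - s * S) (u * s * C + c * S).
  by rewrite /V ltnn eqxx.
have W1 : W m.+1 = cvec (- (c * S + v * s * C)) (v * c * C - s * S).
  by rewrite /W ltnn eqxx.
have V2 : V m.+2 = cvec S (v * C).
  by rewrite /V (ltnNge m.+1) leqnSn /= eqxx gtn_eqF.
have W2 : W m.+2 = cvec (- (u * C)) S.
  by rewrite /W (ltnNge m.+1) leqnSn /= eqxx gtn_eqF.
have V3 : V k = cvec 0 1.
  by rewrite /V leqNgt ltnS leqW //= !gtn_eqF.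
have W3 : W k = cvec (- 1) 0.
  by rewrite /W leqNgt ltnS leqW //= !gtn_eqF.
have V0 : V 0 = cvec 1 0 by rewrite Vle // mul0r cos0 sin0.
have W0 : W 0 = cvec 0 1 by rewrite Wle // mul0r cos0 sin0 oppr0.
have cases j : (j < k)%N -> [\/ (j < m)%N, j = m, j = m.+1 | j = m.+2].
  rewrite /k => jk; have [lt|le] := ltnP j m; first exact: Or41.
  have [->|jm] := eqVneq j m; first exact: Or42.
  have [->|jm1] := eqVneq j m.+1; first exact: Or43.
  by apply: Or44; apply/eqP; rewrite eqn_leq -ltnS jk ltn_neqAle eq_sym jm1 ltn_neqAle eq_sym jm.
have [|||j|j|j|F [Fn F1 Fk FV FW]] := @quarter_turn_extension R k S 1 V W.
- by [].
- by rewrite V3 W0.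
- by rewrite W3 V0; apply: cV2P; rewrite !mxE /= ?oppr0.
- case/cases => [jm|->|->|->].
  + rewrite !Vle ?(ltnW jm) // bracket_cvec tS cosD sinD -/C -/S.
    transitivity ((cos (j%:R * t) ^+ 2 + sin (j%:R * t) ^+ 2) * S); first by ring.
    by rewrite cos2Dsin2 mul1r.
  + by rewrite Vle // V1 bracket_cvec -/c -/s -[RHS]mul1r -cs; ring.
  + rewrite V1 V2 bracket_cvec -[RHS]E -/v.
    transitivity (u * v * c * C ^+ 2 - c * S ^+ 2 - C * S * (u + v) * s); first by ring.
    by rewrite uv; ring.
  + by rewrite V2 V3 bracket_cvec; ring.
- case/cases => [jm|->|->|->].
  + rewrite !Wle ?(ltnW jm) // bracket_cvec tS cosD sinD -/C -/S.
    transitivity ((cos (j%:R * t) ^+ 2 + sin (j%:R * t) ^+ 2) * S); first by ring.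
    by rewrite cos2Dsin2 mul1r.
  + by rewrite Wle // W1 bracket_cvec -/c -/s -[RHS]mul1r -cs; ring.
  + rewrite W1 W2 bracket_cvec -[RHS]E -/v.
    transitivity (u * v * c * C ^+ 2 - c * S ^+ 2 - C * S * (u + v) * s); first by ring.
    by rewrite uv; ring.
  + by rewrite W2 W3 bracket_cvec; ring.
- case/cases => [jm|->|->|->].
  + rewrite Vle ?Wle ?(ltnW jm) // bracket_cvec.
    by transitivity (cos (j%:R * t) ^+ 2 + sin (j%:R * t) ^+ 2); [ring | exact: cos2Dsin2].
  + by rewrite Vle // Wle // bracket_cvec -/c -/s -[RHS]cs; ring.
  + rewrite V1 W1 bracket_cvec.
    transitivity ((u * v * C ^+ 2 + S ^+ 2) * (c ^+ 2 + s ^+ 2)); first by ring.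
    by rewrite uv mul1r cs CS mulr1.
  + rewrite V2 W2 bracket_cvec.
    transitivity (u * v * C ^+ 2 + S ^+ 2); first by ring.
    by rewrite uv mul1r CS.
have Vy j : (0 < j < k)%N -> 0 < V j 1 0.
  move=> /andP[j0 /cases jk]; have [jm|jm] := leqP j m.
    rewrite Vle // cvec1; have [? ?] := jt j jm.
    have : 0 < j%:R * t by rewrite mulr_gt0 // ltr0n.
    by move=> ?; apply: sin_gt0_pihalf; lra.
  case: jk => [lt|jE|->|->].
  - by rewrite ltnNge (ltnW lt) in jm.
  - by rewrite jE ltnn in jm.
  - by rewrite V1 cvec1; apply: addr_gt0; do 2?apply: mulr_gt0.
  - by rewrite V2 cvec1 mulr_gt0.
have Wy j : (j < k)%N -> 0 < W j 1 0.
  move=> /cases jk; have [jm|jm] := leqP j m.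
    rewrite Wle // cvec1; have [? ?] := jt j jm.
    by apply: cos_gt0_pihalf; lra.
  case: jk => [lt|jE|->|->].
  - by rewrite ltnNge (ltnW lt) in jm.
  - by rewrite jE ltnn in jm.
  - by rewrite W1 cvec1; move: key; lra.
  - by rewrite W2 cvec1.
pose r : R := (Num.sqrt S)^-1.
have r0 : 0 < r by rewrite invr_gt0 sqrtr_gt0.
have rr : r * r * S = 1.
  by rewrite -invfM -expr2 sqr_sqrtr ?mulVf ?ltW ?lt0r_neq0.
have [||||j|j|P [PB PF]] := @backlund_of_seq R (2 * k) k (r * r) (fun j => r *: F j).
- exact: n1.
- by move=> j /=; rewrite Fn scalerN.
- by rewrite mxE FV // V0 cvec1 mulr0.
- move=> j /andP[j0 j2]; rewrite mxE; apply: mulr_gt0 => //.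
  have [jk|kj] := ltnP j k; first by rewrite FV // Vy // j0.
  by rewrite -(subnK kj) FW ?Wy // ltn_subLR // addnn -mul2n.
- by rewrite bracketZl bracketZr F1 mulrA.
- by rewrite bracketZl bracketZr Fk mulr1.
exists P; split=> // tP.
have [g Hg] := constant_hill_of_trivial n1 tP.
have Hk := Hg _ lt1.
have H2k := Hg _ lt2.
move: Hk; rewrite -H2k !PF.
rewrite -[m.+4]/(1 + k)%N -[(m.+2 + k).+2]/(1 + k + k)%N !bracketZl !bracketZr.
rewrite [F (1 + k + k)%N](_ : _ = - V 1%N); last first.
  by rewrite -addnA addnn -mul2n Fn FV.
rewrite !FW // FV // V2 W2 Vle // Wle // bracketNr !bracket_cvec mul1r -/C -/S.
move=> H; have := mulr_gt0 (mulr_gt0 r0 r0) (mulr_gt0 S0 C0) => pos.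
have : v < 1 by rewrite invf_lt1.
move=> v1.
have : 0 < (r * r * (S * C)) * (u - v) by apply: mulr_gt0 => //; lra.
lra.
Qed.

Theorem theorem10 (R : realType) (n k : nat)
    (hk : (2 <= k)%N) (hkn : (k <= n - 2)%N) :
  ([\/ k = 2%N, odd n /\ k = 3%N, n = (2 * k + 1)%N | n = (3 * k)%N] ->
    forall P : 'Z_(2 * n) -> 'cV[R]_2,
      self_backlund k P -> trivial_polygon P) /\
  ((~~ odd n /\ odd k) \/ (n = (2 * k)%N /\ (2 < k)%N) ->
    exists P : 'Z_(2 * n) -> 'cV[R]_2,
      self_backlund k P /\ ~ trivial_polygon P).
Proof.
have n3 : (3 < n)%N by lia.
split=> [cases P PB|].
  have n0 : (0 < n)%N by lia.
  have [f1 fn fP [c fc]] := backlund_seq n0 PB.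
  apply: (trivial_of_constant_hill n0 (sb_distinct PB) f1 fn).
  case: cases => [k2|[n_odd k3]|nE|nE].
  - by exists c => j; rewrite -(fc j) k2 addn2.
  - by apply: (@rigid_odd3 R n c) => //; [lia | move=> j; rewrite -(fc j) k3].
  - by apply: (@rigid_2k1 R k c); rewrite -?nE.
  - by apply: (@rigid_3k R k c); rewrite -?nE //; lia.
case=> [[n_even k_odd]|[nE k2]]; first exact: nontrivial_even_odd.
have [k_odd|k_even] := boolP (odd k).
  by apply: nontrivial_even_odd => //; rewrite nE oddM.
case: k hk hkn nE k2 k_even => [|[|[|[|m]]]] // _ _ -> _ _.
exact: nontrivial_radon.
Qed.
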